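(* Let $K\ge1$ be a real number. Any $\mathfrak{RI}_K$-universal rational $K$-based Banach space $X$ is almost $\mathfrak{FI}_1$-universal.
   Context: All Banach spaces are separable and over $\mathbb R$. For a real $K\ge 1$, a normalized $K$-suppression basis of a Banach space $X$ is a subset $B\subset X$ for which there is a family $(e_b^* )_{b\in B}$ of continuous linear functionals on $X$ such that: $\|b\|=1=e_b^*(b)$ for all $b\in B$; $e_b^*(b')=0$ for distinct $b,b'\in B$; $x=\sum_{b\in B}e_b^*(x)\,b$ for every $x\in X$ (meaning that for every $\varepsilon>0$ there is a finite $F\subset B$ with $\|x-\sum_{b\in E}e_b^*(x)b\|<\varepsilon$ for every finite $E$ with $F\subset E\subset B$); and for every finite $F\subset B$ the projection $x\mapsto\sum_{b\in F}e_b^*(x)b$ has norm $\le K$. A $K$-based Banach space is a pair $(X,B_X)$ consisting of a Banach space $X$ and a normalized $K$-suppression basis $B_X$ of $X$ (the trivial space $\{0\}$ with empty basis is allowed). A based Banach space is a $K$-based Banach space for some $K\ge1$. A based Banach space $(X,B_X)$ is a (based) subspace of a based Banach space $(Y,B_Y)$ if $X\subseteq Y$ (a closed linear subspace with the restricted norm) and $B_X=X\cap B_Y$. A $\mathfrak B$-morphism $(X,B_X)\to(Y,B_Y)$ is a continuous linear operator $T:X\to Y$ with $T(B_X)\subseteq B_Y$. An isometry morphism is a $\mathfrak B$-morphism $T$ with $\|T(x)\|_Y=\|x\|_X$ for all $x\in X$. For $\varepsilon>0$, an $\varepsilon$-isometry $\mathfrak B$-morphism is a $\mathfrak B$-morphism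 $T$ with $(1+\varepsilon)^{-1}\|x\|_X<\|T(x)\|_Y<(1+\varepsilon)\|x\|_X$ for all $x\in X\setminus\{0\}$. A finite-dimensional based Banach space $(X,B_X)$ is rational if its closed unit ball is the convex hull of finitely many vectors having rational coordinates in $B_X$. An arbitrary based Banach space is rational if each of its finite-dimensional based subspaces is rational. A based Banach space $X$ is $\mathfrak{RI}_K$-universal if for any rational finite-dimensional $K$-based Banach space $A$, any isometry morphism $f:\Lambda\to X$ defined on a based subspace $\Lambda$ of $A$ can be extended to an isometry morphism $\bar f:A\to X$. A based Banach space $X$ is almost $\mathfrak{FI}_K$-universal if for any $\varepsilon>0$ and any finite-dimensional $K$-based Banach space $A$, any $\varepsilon$-isometry $\mathfrak B$-morphism $f:\Lambda\to X$ defined on a based subspace $\Lambda$ of $A$ can be extended to an $\varepsilon$-isometry $\mathfrak B$-morphism $\bar f:A\to X$; almost $\mathfrak{FI}_1$-universal is the case of $K=1$ in this definition. *)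

(* Defs.v *)
From HB Require Import structures.
From mathcomp Require Import all_boot all_order all_algebra finmap.
From mathcomp Require Import all_classical all_reals topology normedtype.

Set Implicit Arguments.
Unset Strict Implicit.
Unset Printing Implicit Defensive.

Import Order.TTheory GRing.Theory Num.Theory.
Import numFieldNormedType.Exports.

Local Open Scope classical_set_scope.
Local Open Scope ring_scope.

Record closed_subspace (R : realType) (V : completeNormedModType R) := {
  subspace_set : set V;
  subspace0 : subspace_set 0;
  subspaceP : forall (a : R) (x y : V),
    subspace_set x -> subspace_set y -> subspace_set (a *: x + y);
  subspace_closed : closed subspace_set
}.

(* A closed subspace with the restricted norm, as a Banach space in its own
   right; the inclusion into the ambient space is subspace_val. *)
Section ClosedSubspaceType.
Variables (R : realType) (V : completeNormedModType R) (L : closed_subspace V).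

Definition in_subspace : {pred V} := fun x => x \in subspace_set L.

Record subspace_type : Type := InSubspace {
  subspace_val : V;
  _ : subspace_val \in in_subspace
}.

HB.instance Definition _ := [isSub for subspace_val].
HB.instance Definition _ := [Choice of subspace_type by <:].

Fact in_subspace_submod_closed : submod_closed in_subspace.
Proof.
split; first by rewrite unfold_in inE; exact: subspace0.
by move=> a x y; rewrite !unfold_in !inE; exact: subspaceP.
Qed.

HB.instance Definition _ :=
  GRing.isSubmodClosed.Build R V in_subspace in_subspace_submod_closed.
HB.instance Definition _ := [SubChoice_isSubLmodule of subspace_type by <:].

Definition subspace_norm (x : subspace_type) : R := `|subspace_val x|.

Fact subspace_ler_normD (x y : subspace_type) :
  subspace_norm (x + y) <= subspace_norm x + subspace_norm y.
Proof. exact: ler_normD. Qed.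

Fact subspace_normrZ (l : R) (x : subspace_type) :
  subspace_norm (l *: x) = `|l| * subspace_norm x.
Proof. exact: normrZ. Qed.

Fact subspace_normr0_eq0 (x : subspace_type) : subspace_norm x = 0 -> x = 0.
Proof. by move=> /normr0_eq0 x0; apply/val_inj. Qed.

HB.instance Definition _ := Lmodule_isNormed.Build R subspace_type
  subspace_ler_normD subspace_normrZ subspace_normr0_eq0.

Fact subspace_complete (F : set_system subspace_type) :
  ProperFilter F -> cauchy F -> cvg F.
Proof.
move=> FF /cauchy_ballP Fc.
have ballE (x y : subspace_type) e :
    ball x e y = ball (subspace_val x) e (subspace_val y).
  by rewrite -!ball_normE.
have /cauchy_cvg /cvg_ex[l Fl] : cauchy (subspace_val @ F).
  apply/cauchy_ballP => e e0; have := Fc e e0.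
  rewrite !near_simpl.
  by case=> -[A B] /= [FA FB] AB; exists (subspace_val @` A, subspace_val @` B);
    [split; [apply: filterS FA|apply: filterS FB] => x; exists x
    |move=> [_ _] [/= [x Ax <-] [y By <-]]; have := AB (x, y) (conj Ax By);
     rewrite /= ballE].
have Ll : l \in in_subspace.
  rewrite unfold_in inE.
  apply: (@closed_cvg _ _ F FF subspace_val (subspace_set L)) Fl.
    exact: subspace_closed.
  by apply: nearW => -[x] xL; have := xL; rewrite unfold_in inE.
apply/cvg_ex; exists (InSubspace Ll); apply/fcvg_ballP => e e0.
have /cvg_ballP/(_ e e0) := Fl; rewrite !near_simpl => H.
by apply: filterS H => x; rewrite ballE.
Qed.

HB.instance Definition _ :=
  Uniform_isComplete.Build subspace_type subspace_complete.

End ClosedSubspaceType.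

Section Bases.
Variables (R : realType) (X : completeNormedModType R).
Implicit Types (K : R) (B : set X).

Definition separable : Prop := exists2 D : set X, countable D & dense D.

Definition finite_dimensional : Prop :=
  exists n (s : 'I_n -> X), forall x, exists c : 'I_n -> R,
    x = \sum_(i < n) c i *: s i.

(* Only the values of e on B matter. *)
Definition normalized_suppression_basis K B : Prop :=
  exists e : X -> {linear X -> R^o},
    [/\ forall b, B b -> continuous (e b),
        forall b, B b -> `|b| = 1 /\ e b b = 1,
        forall b b', B b -> B b' -> b <> b' -> e b b' = 0,
        forall x (eps : R), 0 < eps ->
          exists2 F : {fset X}, [set` F] `<=` B &
            forall E : {fset X}, [set` F] `<=` [set` E] -> [set` E] `<=` B ->
              `|x - \sum_(b <- E) e b x *: b| < eps
      & forall F : {fset X}, [set` F] `<=` B ->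
          forall x, `|\sum_(b <- F) e b x *: b| <= K * `|x|].

Definition is_K_based K B : Prop :=
  separable /\ normalized_suppression_basis K B.

Definition is_based B : Prop := exists2 K, 1 <= K & is_K_based K B.

(* x is a finite combination of basis vectors with rational coefficients; by
   biorthogonality these are its coordinates in the basis B. *)
Definition rational_coordinates B (x : X) : Prop :=
  exists (F : {fset X}) (q : X -> rat),
    [set` F] `<=` B /\ x = \sum_(b <- F) ratr (q b) *: b.

Definition convex_hull n (v : 'I_n -> X) : set X :=
  [set x | exists t : 'I_n -> R,
    [/\ forall i, 0 <= t i, \sum_(i < n) t i = 1
      & x = \sum_(i < n) t i *: v i]].

Definition rational_fd B : Prop :=
  exists n (v : 'I_n -> X),
    (forall i, rational_coordinates B (v i)) /\
    [set x : X | `|x| <= 1] = convex_hull v.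

End Bases.

Arguments separable {R} X.
Arguments finite_dimensional {R} X.

Section BasedSubspaces.
Variables (R : realType) (X : completeNormedModType R) (B : set X).

Definition subspace_basis (L : closed_subspace X) : set (subspace_type L) :=
  [set x | B (subspace_val x)].

Definition based_subspace (L : closed_subspace X) : Prop :=
  is_based (subspace_basis (L := L)).

Definition rational_based : Prop :=
  forall L : closed_subspace X,
    based_subspace L -> finite_dimensional (subspace_type L) ->
    rational_fd (subspace_basis (L := L)).

End BasedSubspaces.

Arguments subspace_basis {R X} B L _.

Section Morphisms.
Variables (R : realType) (X Y : completeNormedModType R).
Variables (BX : set X) (BY : set Y).

Definition B_morphism (T : {linear X -> Y}) : Prop :=
  continuous T /\ T @` BX `<=` BY.

Definition isometry_morphism (T : {linear X -> Y}) : Prop :=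
  B_morphism T /\ forall x : X, `|T x| = `|x|.

Definition eps_isometry_morphism (eps : R) (T : {linear X -> Y}) : Prop :=
  B_morphism T /\
  forall x : X, x <> 0 -> (1 + eps)^-1 * `|x| < `|T x| < (1 + eps) * `|x|.

End Morphisms.

Section Universality.
Variables (R : realType) (K : R) (X : completeNormedModType R) (BX : set X).

Definition RI_universal : Prop :=
  forall (A : completeNormedModType R) (BA : set A),
    is_K_based K BA -> finite_dimensional A -> rational_fd BA ->
  forall L : closed_subspace A, based_subspace BA L ->
  forall f : {linear subspace_type L -> X},
    isometry_morphism (subspace_basis BA L) BX f ->
  exists2 g : {linear A -> X}, isometry_morphism BA BX g &
    forall x : subspace_type L, g (subspace_val x) = f x.

Definition almost_FI_universal : Prop :=
  forall eps : R, 0 < eps ->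
  forall (A : completeNormedModType R) (BA : set A),
    is_K_based K BA -> finite_dimensional A ->
  forall L : closed_subspace A, based_subspace BA L ->
  forall f : {linear subspace_type L -> X},
    eps_isometry_morphism (subspace_basis BA L) BX eps f ->
  exists2 g : {linear A -> X}, eps_isometry_morphism BA BX eps g &
    forall x : subspace_type L, g (subspace_val x) = f x.

End Universality.

(* Main.v *)
Require Import Defs.
From HB Require Import structures.
From mathcomp Require Import all_boot all_order all_algebra finmap.
From mathcomp Require Import all_classical all_reals topology normedtype derive.
From mathcomp Require Import zify ring lra.

(** Let [f] be an [eps]-isometry from the based subspace [L] of the
    finite-dimensional 1-based space [A] into [X].  The idea is to change the
    norm of [A] so that [f] becomes an exact isometry and [A] becomes rational
    and [K]-based, while the new norm stays strictly [(1 + eps)]-equivalent to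
    the old one.  Universality for rational spaces then extends [f] to an
    isometry from the renormed space, and this extension is an [eps]-isometry
    for the old norm.

    Since the unit sphere of [L] is compact, the strict bounds on [f] hold with
    a constant [M < 1 + eps] ([uniform_strict_ratio]).  The unit ball of the new
    norm is the absolutely convex hull of three finite sets of rational
    vectors:
    - the preimages under [f] of the vertices of the unit ball of [f(L)], which
      is a polytope with rational vertices because [X] is rational
      ([coordinate_span_polytope]);
    - the points of a fine coordinate grid whose old norm is at most [1 / M];
    - the basis vectors of [A].

    Because of the first set the new norm on [L] is at most the norm of [f].
    The coordinate projection of [A] onto [L], which is a contraction
    because [A] is 1-based, followed by [f] maps every vertex into the unit
    ball of [X]; hence the new norm on [L] is also at least the norm of [f]
    ([atomic_norm_span]). The third set gives the basis vectors norm at most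
    1, and the coordinate functionals show that the norm is not smaller
    ([atomic_norm_basis]). Coordinate projections map grid points to grid
    points and basis vectors to basis vectors or 0; on the first set they
    are controlled by the suppression constant [K] of [X]
    ([atomic_norm_proj]). All the vertices have old norm at most [M]
    ([atomic_norm_lower]), and a fine grid fills the ball of radius [1 / M]
    up to a small error ([atomic_norm_upper]). These facts are gathered in
    [exists_polyhedral_norm].

    The new norm is handled as an atomic norm: the least total weight
    [\sum_i `|t i|] of a representation [x = \sum_i t i *: v i].  The triangle
    inequality is then immediate, and bounding a seminorm by the atomic norm
    amounts to bounding it on the vertices ([seminorm_le_atomic_norm]); that
    the minimum is attained is again compactness. *)

Set Implicit Arguments.
Unset Strict Implicit.
Unset Printing Implicit Defensive.

Import Order.TTheory GRing.Theory Num.Theory.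
Import numFieldNormedType.Exports.

Local Open Scope classical_set_scope.
Local Open Scope ring_scope.

(** * Finite suppression bases *)

Lemma linear_le_continuous (R : realType) (V W : normedModType R)
    (T : {linear V -> W}) C :
  (forall x, `|T x| <= C * `|x|) -> continuous T.
Proof.
move=> TC; apply: bounded_linear_continuous; apply/linear_boundedP.
exists C; split; first exact: num_real.
by move=> r /ltW Cr x; apply: le_trans (TC x) _; rewrite ler_wpM2r.
Qed.


Lemma sum_continuous (R : realType) (T : topologicalType) (W : normedModType R)
    (I : Type) (r : seq I) (f : I -> T -> W) :
  (forall i, continuous (f i)) -> continuous (fun x => \sum_(i <- r) f i x).
Proof. by move=> cf x; apply: (cvg_big add_continuous) => i _; exact: cf. Qed.

Lemma singleton_closed (R : realType) (W : normedModType R) (x : W) :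
  closed [set x].
Proof.
by apply: accessible_closed_set1; apply: hausdorff_accessible; exact: norm_hausdorff.
Qed.

Lemma rV_norm_le (R : realType) n (c : 'rV[R]_n) (M : R) :
  0 <= M -> (forall i, `|c ord0 i| <= M) -> `|c| <= M.
Proof.
move=> M0 cM; rewrite [leLHS]/Num.norm /= mx_normrE; apply/bigmax_leP.
by split=> // -[i j] _ /=; rewrite ord1.
Qed.

Section SuppressionSystems.
Variables (R : realType) (V : completeNormedModType R).
Implicit Types (K : R) (B : set V) (F : {fset V}) (e : V -> {linear V -> R^o}).

(** The conditions on the coordinate functionals that pass to subspaces and to
    equivalent norms without change.  Continuity follows from
    [system_coef_le]; for finite bases the expansion of vectors is a finite sum,
    and is assumed separately where it is used. *)
Record suppression_system K B e : Prop := SuppressionSystem {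
  system_norm : forall b, B b -> `|b| = 1;
  system_diag : forall b, B b -> e b b = 1;
  system_offdiag : forall b b', B b -> B b' -> b <> b' -> e b b' = 0;
  system_proj : forall F, [set` F] `<=` B ->
    forall x, `|\sum_(b <- F) e b x *: b| <= K * `|x|
}.

Lemma system_coef_le K B e b x :
  suppression_system K B e -> B b -> `|e b x| <= K * `|x|.
Proof.
move=> se Bb; have sb : [set` [fset b]%fset] `<=` B.
  by move=> y /=; rewrite inE => /eqP ->.
have := system_proj se sb x.
by rewrite big_seq_fset1 normrZ (system_norm se Bb) mulr1.
Qed.

Lemma system_coef_sum K B e F (c : V -> R) b :
  suppression_system K B e -> [set` F] `<=` B -> B b ->
  e b (\sum_(a <- F) c a *: a) = if b \in F then c b else 0.
Proof.
move=> se FB Bb; rewrite linear_sum /=.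
under eq_bigr do rewrite linearZ /=.
case: ifPn => bF.
  rewrite (big_fsetD1 b) //= (system_diag se Bb) big1_fset => [|a].
    by rewrite addr0; exact: mulr1.
  rewrite !inE => /andP[/eqP ab aF] _.
  by rewrite (system_offdiag se Bb (FB _ aF)) ?scaler0// => ba; apply: ab.
rewrite big1_fset // => a aF _.
rewrite (system_offdiag se Bb (FB _ aF)) ?scaler0// => ba.
by rewrite ba aF in bF.
Qed.

(** The vectors with rational coordinates are dense: moving each coordinate by
    less than [r / (#|F| + 1)] moves the vector by less than [r]. *)
Lemma finite_span_separable F e :
  (forall x, x = \sum_(b <- F) e b x *: b) -> (forall b, b \in F -> `|b| = 1) ->
  separable V.
Proof.
move=> span F1.
pose comb (q : {ffun F -> rat}) : V := \sum_(b : F) ratr (q b) *: val b.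
exists (range comb).
  apply: (@card_le_trans _ _ _ [set: {ffun F -> rat}]); first exact: card_image_le.
  exact: countableP.
move=> O [x Ox] Oo; have /nbhs_ballP[r /= r0 rO] : nbhs x O.
  by apply: open_nbhs_nbhs; split.
pose d := r / (#|{: F}|.+1%:R).
have d0 : 0 < d by rewrite divr_gt0.
have qP (b : F) : exists q : rat, ratr q \in `](e (val b) x - d), (e (val b) x)[.
  by apply: rat_in_itvoo; rewrite ltrBlDr ltrDl.
have [q qb] := choice qP.
exists (comb [ffun b => q b]); split; last by exists [ffun b => q b].
apply: rO; rewrite -ball_normE /= {1}(span x) big_seq_fsetE /= -sumrB.
apply: (@le_lt_trans _ _ (\sum_(b : F) d)).
  apply: le_trans (ler_norm_sum _ _ _) _; apply: ler_sum => b _.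
  rewrite ffunE -scalerBl normrZ F1 ?mulr1; last exact: (valP b).
  have := qb b; rewrite in_itv /= => /andP[q1 q2].
  by rewrite ger0_norm ?subr_ge0 ?ltW// ltrBlDr -ltrBlDl.
rewrite sumr_const -mulr_natr /d mulrAC ltr_pdivrMr//.
by rewrite ltr_pM2l// ltr_nat.
Qed.

Lemma finite_system_is_K_based K F e :
  suppression_system K [set` F] e -> (forall x, x = \sum_(b <- F) e b x *: b) ->
  is_K_based K [set` F].
Proof.
move=> se span; split.
  by apply: finite_span_separable span _; exact: system_norm se.
exists e; split.
- move=> b bF; apply: (@linear_le_continuous _ _ _ _ K) => x.
  exact: system_coef_le se bF.
- by move=> b bF; rewrite (system_norm se bF) (system_diag se bF).
- exact: system_offdiag se.
- move=> x eps eps0; exists F => // E FE EF.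
  have -> : E = F by apply/fsetP => b; apply/idP/idP; [exact: EF|exact: FE].
  by rewrite -span subrr normr0.
- exact: system_proj se.
Qed.

Lemma finite_span_fd F e :
  (forall x, x = \sum_(b <- F) e b x *: b) -> finite_dimensional V.
Proof.
move=> span; exists (size F), (fun i => F`_i) => x.
exists (fun i => e F`_i x).
by rewrite {1}(span x) (big_nth 0) big_mkord.
Qed.

(** When the basis is finite the expansion is an honest sum: the index sets of
    the convergence condition eventually equal the whole basis. *)
Lemma basis_suppression_system K B : normalized_suppression_basis K B ->
  exists2 e, suppression_system K B e &
    forall F, B = [set` F] -> forall x, x = \sum_(b <- F) e b x *: b.
Proof.
move=> [e [_ e1 e0 sum_e proj_e]]; exists e.
  by split => // b /e1[].
move=> F BF x; apply/eqP; rewrite -subr_eq0 -normr_le0.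
apply/ler_addgt0Pl => eps /= eps0; rewrite addr0.
have [F' F'B /(_ F)] := sum_e x _ eps0.
by rewrite -BF => /(_ F'B) H; apply/ltW/H.
Qed.

(** If [V] is spanned by [n] vectors and [F] consists of [n + 1] or more basis
    vectors, expanding them on the spanning family and applying the coordinate
    functionals factors an identity matrix through dimension [n]. *)
Lemma system_finite K B e : finite_dimensional V -> suppression_system K B e ->
  finite_set B.
Proof.
move=> [n [s sP]] se; apply: contrapT => /(infinite_set_fset n.+1)[F FB].
apply/negP; rewrite -ltnNge ltnS.
have [c cP] := choice sP.
pose C := \matrix_(j < #|` F|, i < n) c F`_j i.
pose E := \matrix_(i < n, k < #|` F|) (e F`_k (s i) : R).
apply: (@mulmx1_min _ _ _ C E); apply/matrixP => j k; rewrite !mxE.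
have FBn (i : 'I_#|` F|) : B F`_i by apply: FB; rewrite /= mem_nth.
transitivity (e F`_k (\sum_(i < n) c F`_j i *: s i)).
  by rewrite linear_sum /=; apply: eq_bigr => i _; rewrite !mxE linearZ.
rewrite -cP; have [<-|jk] := eqVneq j k; first by rewrite (system_diag se).
rewrite (system_offdiag se)// => /eqP.
by rewrite nth_uniq ?fset_uniq// => /eqP/ord_inj/esym/eqP; rewrite (negbTE jk).
Qed.

End SuppressionSystems.

(** * Coordinate subspaces *)

Section CoordinateProjections.
Variables (R : realType) (V W : completeNormedModType R).
Variables (e : V -> {linear V -> R^o}) (F : {fset V}).

(** The linear map sending [b] to [p b] for [b] in [F] and vanishing on the other
    basis vectors; [p := id] gives the coordinate projections. *)
Definition coordinate_sum (p : V -> W) (x : V) : W := \sum_(b <- F) e b x *: p b.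

Fact coordinate_sum_is_linear p : linear (coordinate_sum p).
Proof.
move=> a x y; rewrite /coordinate_sum scaler_sumr -big_split /=.
by apply: eq_bigr => b _; rewrite linearP scalerDl scalerA.
Qed.

HB.instance Definition _ p := GRing.isLinear.Build R V W *:%R
  (coordinate_sum p) (coordinate_sum_is_linear p).

End CoordinateProjections.

Section Restriction.
Variables (R : realType) (V : completeNormedModType R) (L : closed_subspace V).

Lemma subspace_valP (x : subspace_type L) : subspace_set L (subspace_val x).
Proof. by have := valP x; rewrite unfold_in inE. Qed.

Lemma subspace_val_lin (a : R) (x y : subspace_type L) :
  subspace_val (a *: x + y) = a *: subspace_val x + subspace_val y.
Proof. by []. Qed.

Variables (W : lmodType R) (f : {linear V -> W}).

Definition restrict (x : subspace_type L) : W := f (subspace_val x).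

Fact restrict_is_linear : linear restrict.
Proof. by move=> a x y; rewrite /restrict subspace_val_lin linearP. Qed.

HB.instance Definition _ := GRing.isLinear.Build R (subspace_type L) W *:%R
  restrict restrict_is_linear.

End Restriction.

Section FixedSubspace.
Variables (R : realType) (V : completeNormedModType R) (P : {linear V -> V}).
Hypothesis cP : continuous P.

Fact fixed_subspaceP (a : R) (x y : V) : P x = x -> P y = y ->
  P (a *: x + y) = a *: x + y.
Proof. by move=> Px Py; rewrite linearP Px Py. Qed.

Fact fixed_subspace_closed : closed [set x | P x = x].
Proof.
have -> : [set x | P x = x] = (fun x => P x - x) @^-1` [set 0].
  by apply/seteqP; split=> x /= => [->|/subr0_eq//]; rewrite subrr.
apply: preimage_closed; last first.
  exact: singleton_closed.
by move=> x _; apply: cvgB; [exact: cP|exact: cvg_id].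
Qed.

Definition fixed_subspace : closed_subspace V :=
  @Build_closed_subspace R V [set x | P x = x] (linear0 P) fixed_subspaceP
    fixed_subspace_closed.

End FixedSubspace.

Section BasedSubspaces.
Variables (R : realType) (V : completeNormedModType R) (K : R) (B : set V).
Variables (e : V -> {linear V -> R^o}) (se : suppression_system K B e).
Variable L : closed_subspace V.

Lemma sum_subspace_val (F : {fset subspace_type L}) (c : V -> R) :
  subspace_val (\sum_(b <- F) c (subspace_val b) *: b) =
  \sum_(b <- [fset subspace_val b | b in F]%fset) c b *: b.
Proof.
rewrite big_imfset /=; last by move=> x y _ _; exact: val_inj.
elim/big_rec2: _ => // i y x _ <-.
by rewrite subspace_val_lin.
Qed.

Definition restrict_system (b : subspace_type L) :
  {linear subspace_type L -> R^o} := restrict (L := L) (e (subspace_val b)).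

Lemma restrict_suppression_system :
  suppression_system K (subspace_basis B L) restrict_system.
Proof.
split.
- by move=> b /(system_norm se).
- by move=> b /(system_diag se).
- move=> b b' Bb Bb' bb'; apply: (system_offdiag se) => // vbb'.
  exact/bb'/val_inj.
- move=> F FB x; set c := fun b => e b (subspace_val x).
  rewrite [leLHS](_ : _ = `|subspace_val (\sum_(b <- F) c (subspace_val b) *: b)|)//.
  rewrite sum_subspace_val; apply: (system_proj se) => b /=.
  by move=> /imfsetP[/= b' b'F ->]; exact: (FB _ b'F).
Qed.

(** The basis vectors lying in [L] are exactly those of [F]: the
    coordinate functional of a basis vector outside [F] vanishes on [L], whereas
    it is 1 at that vector. *)
Lemma spanned_subspace_based (F : {fset V}) : [set` F] `<=` B ->
  [set` F] `<=` subspace_set L ->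
  (forall x, subspace_set L x -> x = \sum_(b <- F) e b x *: b) ->
  is_K_based K (subspace_basis B L) /\ finite_dimensional (subspace_type L).
Proof.
move=> FB FL span.
have BLF x : B x -> subspace_set L x -> x \in F.
  move=> Bx /span /(congr1 (e x)); apply: contra_eqT => /negbTE xF.
  rewrite (system_coef_sum (fun b => e b x) se)// xF (system_diag se Bx).
  exact: oner_neq0.
have fin : finite_set (subspace_basis B L).
  apply: (@sub_finite_set _ _ (@subspace_val _ _ L @^-1` [set` F])).
    by move=> x /= Bx; apply: BLF => //; exact: subspace_valP.
  apply: finite_preimage; last exact: finite_fset.
  by move=> x y _ _; exact: val_inj.
have [FL' EF] := (finite_fsetP.1 fin).
have valF : [fset subspace_val b | b in FL']%fset = F.
  apply/fsetP => b; apply/imfsetP/idP => [[/= b' b'F ->]|bF].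
    have : subspace_basis B L b' by rewrite EF.
    by move=> /BLF; apply; exact: subspace_valP.
  have bL : b \in in_subspace L by rewrite unfold_in inE; exact: FL.
  exists (InSubspace bL) => //=.
  have : subspace_basis B L (InSubspace bL) by exact: FB.
  by rewrite EF.
have spanL (x : subspace_type L) : x = \sum_(b <- FL') restrict_system b x *: b.
  apply: val_inj; set c := fun b => e b (subspace_val x).
  rewrite [RHS](_ : _ = subspace_val (\sum_(b <- FL') c (subspace_val b) *: b))//.
  by rewrite sum_subspace_val valF; apply: span; exact: subspace_valP.
split; last exact: finite_span_fd spanL.
have := restrict_suppression_system; rewrite EF => seL.
exact: finite_system_is_K_based seL spanL.
Qed.

End BasedSubspaces.

(** * Equivalent renormings *)

Section Renorming.
Variables (R : realType) (V : completeNormedModType R).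

Record equivalent_norm := EquivalentNorm {
  eqnorm :> V -> R;
  eqnormD : forall x y, eqnorm (x + y) <= eqnorm x + eqnorm y;
  eqnormZ : forall a x, eqnorm (a *: x) = `|a| * eqnorm x;
  eqnorm_lower : exists C, forall x, `|x| <= C * eqnorm x;
  eqnorm_upper : exists C, forall x, eqnorm x <= C * `|x|
}.

(** The norm is an argument of the type so that different norms on the same
    vector space give different normed spaces. *)
Definition renormed_type of equivalent_norm : Type := V.

Variable N : equivalent_norm.

Local Notation renormed := (renormed_type N).

HB.instance Definition _ := GRing.Lmodule.copy renormed V.

Fact renormed_eq0 (x : renormed) : N x = 0 -> x = 0.
Proof.
move=> Nx; have [C /(_ x)] := eqnorm_lower N.
by rewrite Nx mulr0 normr_le0 => /eqP.
Qed.

HB.instance Definition _ := Lmodule_isNormed.Build R renormed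
  (@eqnormD N) (@eqnormZ N) renormed_eq0.

Lemma eqnorm_lower_gt0 : exists2 C, 0 < C & forall x, `|x| <= C * N x.
Proof.
have [C NC] := eqnorm_lower N; exists (`|C| + 1); first exact: ltr_wpDl.
move=> x; apply: le_trans (NC x) _; rewrite ler_wpM2r//.
  exact: (normr_ge0 (x : renormed)).
by rewrite ler_wpDr// ler_norm.
Qed.

Lemma eqnorm_upper_gt0 : exists2 C, 0 < C & forall x, N x <= C * `|x|.
Proof.
have [C NC] := eqnorm_upper N; exists (`|C| + 1); first exact: ltr_wpDl.
move=> x; apply: le_trans (NC x) _; rewrite ler_wpM2r//.
by rewrite ler_wpDr// ler_norm.
Qed.

Fact renormed_complete (F : set_system renormed) :
  ProperFilter F -> cauchy F -> cvg F.
Proof.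
move=> FF /cauchy_ballP Fc.
have [C C0 NC] := eqnorm_lower_gt0; have [D D0 ND] := eqnorm_upper_gt0.
have /cauchy_cvg /cvg_ex[l Fl] : @cauchy V F.
  apply/cauchy_ballP => e e0; have := Fc (e / C) (divr_gt0 e0 C0).
  rewrite !near_simpl; apply: filterS => -[x y].
  rewrite -!ball_normE /= => xy.
  by apply: le_lt_trans (NC _) _; rewrite mulrC -ltr_pdivlMr.
apply/cvg_ex; exists (l : renormed); apply/fcvg_ballP => e e0.
have /cvg_ballP/(_ (e / D) (divr_gt0 e0 D0)) := Fl.
rewrite !near_simpl; apply: filterS => y.
rewrite -!ball_normE /= => ly.
by apply: le_lt_trans (ND _) _; rewrite mulrC -ltr_pdivlMr.
Qed.

HB.instance Definition _ := Uniform_isComplete.Build renormed renormed_complete.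

Fact renormed_closed (A : set V) : closed A -> closed (A : set renormed).
Proof.
have [C NC] := eqnorm_lower N.
pose i : {linear renormed -> V} := (idfun : {linear V -> V}).
have ci : continuous i by exact: (@linear_le_continuous _ _ _ _ C).
by move=> cA; have := @preimage_closed _ _ i A (fun x _ => ci x) cA.
Qed.

Definition renormed_subspace (L : closed_subspace V) : closed_subspace renormed :=
  @Build_closed_subspace R renormed (subspace_set L)
    (subspace0 L) (@subspaceP _ _ L)
    (renormed_closed (@subspace_closed _ _ L)).

Definition renormed_linear (W : lmodType R) (f : {linear V -> W}) :
  {linear renormed -> W} := f.

End Renorming.

(** * Atomic norms and polytopes *)

Section AtomicNorm.
Variables (R : realType) (V : completeNormedModType R).
Variables (I : finType) (v : I -> V).

(** The gauge of the absolutely convex hull of the [v i]. *)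
Definition atomic_norm (x : V) : R :=
  inf [set \sum_i `|t i| | t in [set t : I -> R | x = \sum_i t i *: v i]].

Lemma atomic_norm_le x (t : I -> R) :
  x = \sum_i t i *: v i -> atomic_norm x <= \sum_i `|t i|.
Proof.
move=> xt; apply: ge_inf; last by exists t.
by exists 0 => _ [s _ <-]; exact: sumr_ge0.
Qed.

Lemma atomic_norm_atom i : atomic_norm (v i) <= 1.
Proof.
have -> : 1 = \sum_j `|(j == i)%:R : R|.
  rewrite (bigD1 i)//= eqxx normr1 big1 ?addr0// => j /negbTE ->.
  by rewrite normr0.
apply: atomic_norm_le; rewrite (bigD1 i)//= eqxx scale1r big1 ?addr0// => j.
by move=> /negbTE ->; rewrite scale0r.
Qed.

Hypothesis span : forall x, exists t : I -> R, x = \sum_i t i *: v i.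

(** The representations of total weight at most that of a given one form a
    compact set of coefficient vectors, on which the weight is continuous. *)
Lemma atomic_norm_attained x :
  exists2 t : I -> R, x = \sum_i t i *: v i & atomic_norm x = \sum_i `|t i|.
Proof.
suff [t xt tmin] : exists2 t : I -> R, x = \sum_i t i *: v i &
    forall s : I -> R, x = \sum_i s i *: v i -> \sum_i `|t i| <= \sum_i `|s i|.
  exists t => //; apply/eqP; rewrite eq_le atomic_norm_le//=.
  apply: lb_le_inf; first by exists (\sum_i `|t i|), t.
  by move=> _ [s /= xs <-]; exact: tmin.
have [t0 xt0] := span x; set M := \sum_i `|t0 i|.
have M0 : 0 <= M by exact: sumr_ge0.
pose fn (c : 'rV[R]_#|I|) i := c ord0 (enum_rank i).
have cfn i : continuous (fn^~ i) by exact: coord_continuous.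
pose comb c := \sum_i fn c i *: v i; pose wt c : R := \sum_i `|fn c i|.
have ccomb : continuous comb.
  by apply: sum_continuous => i c; exact: (cvgZ (cfn i c) (cvg_cst _)).
have cwt : continuous wt.
  by apply: sum_continuous => i c; exact: (cvg_norm (cfn i c)).
pose ofn (t : I -> R) : 'rV[R]_#|I| := \row_j t (enum_val j).
have fnK t : fn (ofn t) = t by apply/funext => i; rewrite /fn mxE enum_rankK.
pose A := [set c | comb c = x /\ wt c <= M].
have [||c] := @compact_EVT_min _ R wt A _ _ (continuous_subspaceT cwt).
- by exists (ofn t0); rewrite /A /= /comb /wt fnK.
- apply: bounded_closed_compact.
    exists M; split; first exact: num_real.
    move=> N MN c [_ cM]; apply: le_trans (ltW MN); apply: le_trans cM.
    apply: rV_norm_le => [|j]; first exact: sumr_ge0.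
    rewrite /wt (bigD1 (enum_val j))//= /fn enum_valK lerDl.
    exact: sumr_ge0.
  have -> : A = (comb @^-1` [set x]) `&` (wt @^-1` [set y | y <= M]).
    by apply/seteqP; split => c.
  apply: closedI; apply: preimage_closed.
  - by move=> c _; exact: ccomb.
  - exact: singleton_closed.
  - by move=> c _; exact: cwt.
  - exact: closed_le.
rewrite inE => -[cx cM] cmin; exists (fn c); first by rewrite -cx.
move=> s xs; have [sM|/ltW Ms] := leP (\sum_i `|s i|) M; last exact: le_trans Ms.
have := cmin (ofn s); rewrite /wt fnK; apply.
by rewrite inE /A /= /comb /wt fnK.
Qed.

Lemma atomic_normD x y : atomic_norm (x + y) <= atomic_norm x + atomic_norm y.
Proof.
have [t xt ->] := atomic_norm_attained x; have [s ys ->] := atomic_norm_attained y.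
rewrite -big_split /=; apply: (@le_trans _ _ (\sum_i `|t i + s i|)).
  apply: atomic_norm_le; rewrite [in LHS]xt ys -big_split /=.
  by apply: eq_bigr => i _; rewrite scalerDl.
by apply: ler_sum => i _; exact: ler_normD.
Qed.

Lemma atomic_normZ a x : atomic_norm (a *: x) = `|a| * atomic_norm x.
Proof.
have le b y : atomic_norm (b *: y) <= `|b| * atomic_norm y.
  have [t yt ->] := atomic_norm_attained y; rewrite mulr_sumr.
  under eq_bigr do rewrite -normrM; apply: atomic_norm_le.
  by rewrite [in LHS]yt scaler_sumr; apply: eq_bigr => i _; rewrite scalerA.
apply/eqP; rewrite eq_le le /=; have [->|a0] := eqVneq a 0.
  rewrite normr0 mul0r scale0r.
  by have [t _ ->] := atomic_norm_attained 0; exact: sumr_ge0.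
have := le a^-1 (a *: x); rewrite scalerA mulVf// scale1r normfV.
by rewrite ler_pdivlMl ?normr_gt0.
Qed.

Lemma atomic_norm0 : atomic_norm 0 = 0.
Proof. by rewrite -(scale0r (0 : V)) atomic_normZ normr0 mul0r. Qed.

Lemma atomic_norm_sum_le (J : Type) (r : seq J) (P : pred J) (x : J -> V) :
  atomic_norm (\sum_(j <- r | P j) x j) <=
  \sum_(j <- r | P j) atomic_norm (x j).
Proof.
elim/big_ind2: _ => [|a b c d ab cd|//]; first by rewrite atomic_norm0.
by apply: le_trans (atomic_normD _ _) _; exact: lerD.
Qed.

(** The atomic norm is the largest seminorm that is at most 1 on the atoms. *)
Lemma seminorm_le_atomic_norm (q : V -> R) (c : R) :
  (forall x y, q (x + y) <= q x + q y) ->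
  (forall a x, q (a *: x) = `|a| * q x) ->
  (forall i, q (v i) <= c) -> forall x, q x <= c * atomic_norm x.
Proof.
move=> qD qZ qc x; have [t xt ->] := atomic_norm_attained x.
have q0 : q 0 = 0 by rewrite -(scale0r (0 : V)) qZ normr0 mul0r.
apply: (@le_trans _ _ (\sum_i q (t i *: v i))).
  rewrite [in leLHS]xt; elim/big_ind2 : _ => [|a b y z ab yz|//].
    by rewrite q0.
  by apply: le_trans (qD _ _) _; exact: lerD.
by rewrite mulr_sumr; apply: ler_sum => i _; rewrite qZ mulrC ler_wpM2r.
Qed.

Lemma atomic_ballP x : (atomic_norm x <= 1) <->
  exists2 t : I -> R, x = \sum_i t i *: v i & \sum_i `|t i| <= 1.
Proof.
split => [|[t xt t1]]; last exact: le_trans (atomic_norm_le xt) t1.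
by have [t xt ->] := atomic_norm_attained x; exists t.
Qed.

End AtomicNorm.

Section SymmetricHull.
Variables (R : realType) (V : completeNormedModType R) (B : set V).

Lemma rational_coordinates0 : rational_coordinates B 0.
Proof.
exists fset0, (fun=> 0); rewrite big_seq_fset0; split=> // x.
Qed.

Lemma rational_coordinatesN x :
  rational_coordinates B x -> rational_coordinates B (- x).
Proof.
move=> [F [q [FB ->]]]; exists F, (fun b => - q b); split=> //.
by rewrite -sumrN; apply: eq_bigr => b _; rewrite rmorphN scaleNr.
Qed.

(** An absolutely convex hull is the convex hull of the atoms, their opposites
    and 0.  The extra vertex 0 absorbs the missing weight
    [1 - \sum_i `|t i|], and it keeps the hull nonempty when there are no
    atoms. *)
Lemma symmetric_hull_rational_fd (I : finType) (v : I -> V) :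
  (forall i, rational_coordinates B (v i)) ->
  (forall x, `|x| <= 1 <->
    exists2 t : I -> R, x = \sum_i t i *: v i & \sum_i `|t i| <= 1) ->
  rational_fd B.
Proof.
move=> vB ballP; pose J : finType := (unit + I * bool)%type.
pose u (j : J) := match j with
  | inl _ => 0 | inr (i, b) => if b then - v i else v i end.
have sumJ (W : zmodType) (g : J -> W) : \sum_j g j =
    g (inl tt) + \sum_i (g (inr (i, true)) + g (inr (i, false))).
  rewrite big_sumType /= (big_pred1 tt); last by case.
  congr (_ + _).
  transitivity (\sum_i \sum_(b : bool) g (inr (i, b))).
    by rewrite pair_bigA; apply: eq_bigr => -[].
  by apply: eq_bigr => i _; rewrite big_bool.
have sumE (W : zmodType) (g : J -> W) : \sum_(k < #|J|) g (enum_val k) = \sum_j g j.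
  by rewrite [RHS](reindex (@enum_val _ J)) //; exact/onW_bij/enum_val_bij.
exists #|J|, (fun k => u (enum_val k)); split.
  move=> k; case: (enum_val k) => [_|[i []]] /=.
  - exact: rational_coordinates0.
  - exact: rational_coordinatesN.
  - exact: vB.
apply/seteqP; split => x /=.
  move=> /ballP[t xt t1].
  (* The positive and negative parts of [t i] go to [v i] and [- v i]. *)
  pose s (j : J) : R := match j with
    | inl _ => 1 - \sum_i `|t i|
    | inr (i, b) => (`|t i| + (if b then - t i else t i)) / 2 end.
  exists (fun k => s (enum_val k)); split.
  + move=> k; case: (enum_val k) => [_|[i b]] /=; first by rewrite subr_ge0.
    have := ler_norm (t i); have := ler_norm (- t i); rewrite normrN.
    by case: b; lra.
  + rewrite (sumE _ s) sumJ /= -[RHS](subrK (\sum_i `|t i|)); congr (_ + _).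
    by apply: eq_bigr => i _; field.
  + rewrite (sumE _ (fun j => s j *: u j)) sumJ /= scaler0 add0r xt.
    apply: eq_bigr => i _; rewrite scalerN -scaleNr -scalerDl.
    by congr (_ *: _); field.
move=> [s [s0 s1 ->]]; apply/ballP.
pose r j := s (enum_rank j).
have sr k : s k = r (enum_val k) by rewrite /r enum_valK.
exists (fun i => r (inr (i, false)) - r (inr (i, true))).
  under eq_bigr do rewrite sr.
  rewrite (sumE _ (fun j => r j *: u j)) sumJ /= scaler0 add0r.
  by apply: eq_bigr => i _; rewrite scalerN scalerBl addrC.
have r0 j : 0 <= r j by exact: s0.
have <- : \sum_j r j = 1 by rewrite -s1 -sumE; apply: eq_bigr => k _.
rewrite sumJ; apply: ler_wpDl => //; apply: ler_sum => i _.
by apply: le_trans (ler_normB _ _) _; rewrite !ger0_norm// addrC.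
Qed.

End SymmetricHull.

(** * Compactness of the unit sphere *)

Section CompactSphere.
Variables (R : realType) (V : completeNormedModType R) (K : R) (F : {fset V}).
Variables (e : V -> {linear V -> R^o}).
Hypothesis se : suppression_system K [set` F] e.
Hypothesis span : forall x, x = \sum_(b <- F) e b x *: b.

(** The sphere is the image of a closed bounded set of coefficient vectors, the
    coordinates of a unit vector being bounded by [K]. *)
Lemma compact_sphere : compact [set x : V | `|x| = 1].
Proof.
pose comb (c : 'rV[R]_(size F)) : V := \sum_(i < size F) c ord0 i *: F`_i.
have ccomb : continuous comb.
  apply: sum_continuous => i c.
  have ci := @coord_continuous R _ _ ord0 i c.
  exact: (cvgZ ci (cvg_cst _)).
pose A := [set c | `|comb c| = 1 /\ `|c| <= K].
have -> : [set x : V | `|x| = 1] = comb @` A.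
  apply/seteqP; split => x /=; last by move=> [c [c1 _] <-].
  move=> x1; pose c := \row_(i < size F) (e F`_i x : R).
  have cx : comb c = x.
    rewrite [RHS]span (big_nth 0) big_mkord; apply: eq_bigr => i _.
    by rewrite mxE.
  have cK (i : 'I_(size F)) : `|c ord0 i| <= K.
    rewrite mxE -[K]mulr1 -x1; apply: (system_coef_le _ se).
    by rewrite /= mem_nth.
  exists c => //; split; first by rewrite cx.
  (* Without basis vectors the bound [0 <= K] is not given by [cK]. *)
  apply: rV_norm_le cK; have s0 : [set` fset0] `<=` [set` F] by [].
  by have := system_proj se s0 x; rewrite big_seq_fset0 normr0 x1 mulr1.
apply: continuous_compact; first exact: continuous_subspaceT.
apply: bounded_closed_compact.
  exists K; split; first exact: num_real.
  by move=> N KN c [_ cK]; exact: le_trans cK (ltW KN).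
have -> : A = ((fun c => `|comb c|) @^-1` [set 1]) `&`
    ((fun c : 'rV[R]_(size F) => `|c|) @^-1` [set y | y <= K]).
  by apply/seteqP; split => c.
apply: closedI; apply: preimage_closed.
- by move=> c _; exact: (cvg_norm (ccomb c)).
- exact: singleton_closed.
- by move=> c _; exact: norm_continuous.
- exact: closed_le.
Qed.

Lemma uniform_strict_ratio (p q : V -> R) :
  continuous p -> continuous q ->
  (forall a x, p (a *: x) = `|a| * p x) -> (forall a x, q (a *: x) = `|a| * q x) ->
  (forall x, x != 0 -> 0 < q x /\ p x < q x) ->
  exists2 t, t < 1 & forall x, p x <= t * q x.
Proof.
move=> cp cq pZ qZ pq.
have p0 : p 0 = 0 by rewrite -(scale0r (0 : V)) pZ normr0 mul0r.
have q0 : q 0 = 0 by rewrite -(scale0r (0 : V)) qZ normr0 mul0r.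
suff [t t1 pt] : exists2 t, t < 1 & forall x, `|x| = 1 -> p x <= t * q x.
  exists t => // x; have [->|x0] := eqVneq x 0; first by rewrite p0 q0 mulr0.
  have xn : 0 < `|x| by rewrite normr_gt0.
  have x1 : `| `|x|^-1 *: x | = 1.
    by rewrite normrZ ger0_norm ?invr_ge0// mulVf// gt_eqF.
  have := pt _ x1; rewrite pZ qZ mulrCA ger0_norm ?invr_ge0//.
  by rewrite ler_pM2l ?invr_gt0.
have sph0 (x : V) : `|x| = 1 -> x != 0 by move=> x1; rewrite -(normr_gt0 x) x1.
have [[x1 nx1]|no] := pselect (exists x : V, `|x| = 1); last first.
  by exists 0 => // x x1; case: no; exists x.
have cpq : {within [set x : V | `|x| = 1], continuous (fun x => p x / q x)}.
  apply: continuous_in_subspaceT => x; rewrite inE /= => /sph0/pq[qx _].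
  by apply: cvgM; [exact: cp|apply: cvgV; [rewrite gt_eqF|exact: cq]].
have [|c] := compact_EVT_max _ compact_sphere cpq; first by exists x1.
rewrite inE /= => /sph0/pq[qc pc] cmax.
exists (p c / q c); first by rewrite ltr_pdivrMr// mul1r.
move=> x x1'; have [qx _] := pq _ (sph0 _ x1').
by rewrite -ler_pdivrMr//; apply: cmax; rewrite inE.
Qed.

End CompactSphere.

(** * A rational polyhedral norm extending a given one *)

(** With [s := k / m], the second bound amounts to
    [s * (2 + eps) < (1 + eps) / M - 1], and the right-hand side is positive. *)
Lemma exists_mesh (R : realType) (eps M : R) (k : nat) :
  0 < eps -> 1 <= M -> M < 1 + eps ->
  exists m, [/\ (0 < m)%N, k%:R / m%:R < M^-1 :> R
    & (1 + k%:R / m%:R) / (M^-1 - k%:R / m%:R) < 1 + eps].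
Proof.
move=> eps0 M1 Meps; have M0 : 0 < M by exact: lt_le_trans M1.
pose d := ((1 + eps) / M - 1) / (2 + eps).
have e2 : 0 < 2 + eps by rewrite ltr_wpDl.
have d0 : 0 < d by rewrite divr_gt0// subr_gt0 ltr_pdivlMr// mul1r.
pose m := Num.bound (k%:R / d).
have km : k%:R / d < m%:R :> R by apply: archi_boundP; rewrite divr_ge0// ltW.
have mR : 0 < m%:R :> R by apply: le_lt_trans km; rewrite divr_ge0// ltW.
have sd : k%:R / m%:R < d by rewrite ltr_pdivrMr// mulrC -ltr_pdivrMr.
set s := k%:R / m%:R in sd *.
have sd' : s * (2 + eps) < (1 + eps) / M - 1 by rewrite -ltr_pdivlMr.
have sM : s < M^-1.
  rewrite -subr_gt0 -(pmulr_rgt0 _ (_ : 0 < 1 + eps)) ?ltr_wpDl//.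
  have s0 : 0 <= s by rewrite divr_ge0.
  rewrite mulrBr; lra.
exists m; split => //.
rewrite ltr_pdivrMr ?subr_gt0// -/s.
by move: sd'; rewrite mulrDr mulrBr mulrDl (mulrC s eps) !mulrDl; lra.
Qed.

(** Here [G] is the basis of the subspace on which the norm is prescribed, [h]
    is the prescribed map composed with the coordinate projection onto that
    subspace, and [u] lists the rational vertices of the unit ball of the image
    of [h].  The subspace itself is represented by the equation
    [proj G x = x]. *)
Section PolyhedralNorm.
Variables (R : realType) (A X : completeNormedModType R).
Variables (F : {fset A}) (e : A -> {linear A -> R^o}).
Hypothesis se : suppression_system 1 [set` F] e.
Hypothesis span : forall x, x = \sum_(b <- F) e b x *: b.
Variables (K : R) (BX : set X) (eX : X -> {linear X -> R^o}).
Hypothesis K1 : 1 <= K.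
Hypothesis seX : suppression_system K BX eX.
Variables (G : {fset A}) (h : {linear A -> X}) (M : R).
Hypothesis GF : (G `<=` F)%fset.
Hypothesis hG : forall b, b \in G -> BX (h b).
Hypothesis h0 : forall b, b \in F -> b \notin G -> h b = 0.

Local Notation proj H := (coordinate_sum e H id).

Hypothesis M1 : 1 <= M.
Hypothesis h_le : forall x, proj G x = x -> `|h x| <= M * `|x|.
Hypothesis h_ge : forall x, proj G x = x -> `|x| <= M * `|h x|.

Variables (n : nat) (u : 'I_n -> X).
Hypothesis u_span : forall i, \sum_(b <- G) eX (h b) (u i) *: h b = u i.
Hypothesis u_rat : forall i b, b \in G -> exists rho : rat, eX (h b) (u i) = ratr rho.
Hypothesis u_le1 : forall i, `|u i| <= 1.
Hypothesis u_hull : forall x, proj G x = x -> `|h x| <= 1 ->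
  exists t : 'I_n -> R, [/\ forall i, 0 <= t i, \sum_(i < n) t i = 1
    & h x = \sum_(i < n) t i *: u i].

Let M0 : 0 < M. Proof. exact: lt_le_trans M1. Qed.

Let G_sub b : b \in G -> b \in F. Proof. exact: (fsubsetP GF). Qed.

Let e_sum (H : {fset A}) (c : A -> R) b : (H `<=` F)%fset -> b \in F ->
  e b (\sum_(a <- H) c a *: a) = if b \in H then c b else 0.
Proof. by move=> HF bF; apply: (system_coef_sum c se) => // a; apply: (fsubsetP HF). Qed.

Lemma eq_coef x y : (forall b, b \in F -> e b x = e b y) -> x = y.
Proof.
by move=> xy; rewrite (span x) (span y); apply: eq_big_seq => b /xy ->.
Qed.

Lemma e_proj (H : {fset A}) b x : (H `<=` F)%fset -> b \in F ->
  e b (proj H x) = if b \in H then e b x else 0.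
Proof. exact: e_sum. Qed.

Lemma proj_sum (H : {fset A}) (c : A -> R) : (H `<=` G)%fset ->
  proj G (\sum_(b <- H) c b *: b) = \sum_(b <- H) c b *: b.
Proof.
move=> HG; have HF := fsubset_trans HG GF.
apply: eq_coef => b bF; rewrite e_proj// !e_sum//.
case: ifPn => // bG; case: ifPn => // bH.
by rewrite (fsubsetP HG _ bH) in bG.
Qed.

Lemma proj_le (H : {fset A}) x : (H `<=` F)%fset -> `|proj H x| <= `|x|.
Proof.
move=> HF; rewrite -[leRHS]mul1r; apply: (system_proj se) => b.
exact: (fsubsetP HF).
Qed.

Lemma h_proj x : h (proj G x) = h x.
Proof.
rewrite [in RHS](span x) !linear_sum /=; apply: big_fset_incl => // b bF bG.
by rewrite linearZ /= h0// scaler0.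
Qed.

Definition hull_atom i : A := \sum_(b <- G) (eX (h b) (u i) : R) *: b.

Lemma h_hull_atom i : h (hull_atom i) = u i.
Proof.
rewrite -[RHS]u_span linear_sum /=; apply: eq_bigr => b _.
by rewrite linearZ.
Qed.

Lemma proj_hull_atom i : proj G (hull_atom i) = hull_atom i.
Proof. exact: proj_sum. Qed.

Lemma h_inj x y : proj G x = x -> proj G y = y -> h x = h y -> x = y.
Proof.
move=> Gx Gy hxy; apply/eqP; rewrite -subr_eq0 -normr_le0.
by rewrite (le_trans (h_ge _)) ?linearB /= ?Gx ?Gy// hxy subrr normr0 mulr0.
Qed.

Section Mesh.
Variable m : nat.
Hypothesis m0 : (0 < m)%N.

Definition grid_point (k : A -> int) : A := \sum_(b <- F) ((k b)%:~R / m%:R : R) *: b.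

Definition grid : set A := [set x | `|x| <= M^-1 /\ exists k, x = grid_point k].

(** A grid point of norm at most [1 / M <= 1] has coordinates in [-1, 1], hence
    numerators between [- m] and [m]. *)
Lemma finite_grid : finite_set grid.
Proof.
pose c (g : {ffun F -> 'I_(m + m).+1}) (b : A) : int :=
  if insub b is Some b' then (g b' : nat)%:Z - m%:Z else 0.
apply: (@sub_finite_set _ _ (range (fun g => grid_point (c g)))); last first.
  exact: finite_image.
move=> x [xM [k xk]] /=; rewrite {x}xk in xM *.
exists [ffun b : F => inord `|(k (val b) + m%:Z)%R|%N] => //.
apply: eq_big_seq => b bF; congr ((_%:~R / _) *: _); rewrite /c insubT /= ffunE /=.
have kb : `|k b| <= m%:Z.
  have := system_coef_le (grid_point k) se bF.
  rewrite mul1r e_sum// bF => kb; have := le_trans kb xM.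
  move=> {}kb; have {}kb := le_trans kb (_ : M^-1 <= 1).
  have /kb : M^-1 <= 1 by rewrite invf_le1.
  rewrite normrM normfV ler_pdivrMr ?normr_gt0 ?pnatr_eq0 -?lt0n// mul1r.
  by rewrite -intr_norm normr_nat -(ler_int R).
rewrite inordK; last first.
  by lia.
lia.
Qed.

Definition atoms : seq A :=
  [seq hull_atom i | i <- enum 'I_n] ++ fset_set grid ++ F.

Definition atom (i : 'I_(size atoms)) : A := atoms`_i.

Variant atom_spec : A -> Prop :=
  | HullAtom i : atom_spec (hull_atom i)
  | GridAtom x of grid x : atom_spec x
  | BasisAtom b of b \in F : atom_spec b.

Lemma atomP i : atom_spec (atom i).
Proof.
have := mem_nth 0 (ltn_ord i); rewrite -/(atom i).
rewrite !mem_cat => /or3P[/mapP[j _ ->]||]; [exact: HullAtom| |exact: BasisAtom].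
by rewrite in_fset_set ?inE; [exact: GridAtom|exact: finite_grid].
Qed.

Local Notation N := (atomic_norm atom).

Lemma atoms_le1 x : x \in atoms -> N x <= 1.
Proof.
move=> xs; have ix : (index x atoms < size atoms)%N by rewrite index_mem.
have -> : x = atom (Ordinal ix) by rewrite /atom /= nth_index.
exact: atomic_norm_atom.
Qed.

Lemma hull_atom_le1 i : N (hull_atom i) <= 1.
Proof. by apply: atoms_le1; rewrite mem_cat map_f// mem_enum. Qed.

Lemma grid_le1 x : grid x -> N x <= 1.
Proof.
move=> gx; apply: atoms_le1; rewrite !mem_cat in_fset_set; last exact: finite_grid.
by rewrite mem_set ?orbT.
Qed.

Lemma basis_le1 b : b \in F -> N b <= 1.
Proof. by move=> bF; apply: atoms_le1; rewrite !mem_cat bF !orbT. Qed.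

Lemma atom_span x : exists t, x = \sum_i t i *: atom i.
Proof.
have memF b : b \in F -> exists t, b = \sum_i t i *: atom i.
  move=> bF; have bs : b \in atoms by rewrite !mem_cat bF !orbT.
  have ib : (index b atoms < size atoms)%N by rewrite index_mem.
  exists (fun j => (j == Ordinal ib)%:R); rewrite (bigD1 (Ordinal ib))//= eqxx.
  rewrite scale1r /atom /= nth_index// big1 ?addr0// => j /negbTE ->.
  by rewrite scale0r.
rewrite (span x) big_seq; elim/big_ind: _ => [|y z [t ->] [s ->]|b bF].
- by exists (fun=> 0); rewrite big1 // => i; rewrite scale0r.
- exists (fun i => t i + s i); rewrite -big_split /=.
  by apply: eq_bigr => i _; rewrite scalerDl.
- have [t bt] := memF b bF; exists (fun i => (e b x : R) * t i).
  transitivity ((e b x : R) *: \sum_i t i *: atom i); first by rewrite -bt.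
  by rewrite scaler_sumr; apply: eq_bigr => i _; rewrite scalerA.
Qed.

Let ND := atomic_normD atom_span.
Let NZ := atomic_normZ atom_span.
Let Nge := seminorm_le_atomic_norm atom_span.

Let N0 := atomic_norm0 atom_span.
Let Nsum_le := atomic_norm_sum_le atom_span.

Lemma atomic_norm_lower x : `|x| <= M * N x.
Proof.
apply: (Nge (q := fun x => `|x|)) => [||i]; [exact: ler_normD|exact: normrZ|].
case: (atomP i) => [{}i|y [yM _]|b bF].
- apply: le_trans (h_ge (proj_hull_atom i)) _.
  by rewrite h_hull_atom -[leRHS]mulr1 ler_pM2l.
- by apply: le_trans yM _; apply: le_trans M1; rewrite invf_le1.
- by rewrite (system_norm se bF).
Qed.

(** As [A] is 1-based, the projection onto the span of [G] does not increase the
    norm of a grid point, so [h] multiplies it by at most [M], which the radius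
    [1 / M] of the grid compensates. *)
Lemma h_le_atomic_norm x : `|h x| <= N x.
Proof.
rewrite -[leRHS]mul1r; apply: (Nge (q := fun x => `|h x|)) => [a b|a b|i].
- by rewrite linearD ler_normD.
- by rewrite linearZ normrZ.
case: (atomP i) => [{}i|y [yM _]|b bF].
- by rewrite h_hull_atom.
- have Gy : proj G (proj G y) = proj G y by exact: proj_sum.
  rewrite -h_proj; apply: le_trans (h_le Gy) _.
  rewrite -ler_pdivlMl// mulr1; apply: le_trans yM.
  exact: proj_le.
- have [/hG/(system_norm seX) ->//|bG] := boolP (b \in G).
  by rewrite h0// normr0.
Qed.

(** If [h x] has norm 1 it is a convex combination of the [u i]; as [h] is
    injective on the span of [G], [x] is the same combination of the atoms
    above the [u i]. *)
Lemma atomic_norm_span x : proj G x = x -> N x = `|h x|.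
Proof.
move=> Gx; apply/eqP; rewrite eq_le h_le_atomic_norm andbT.
have [->|x0] := eqVneq x 0; first by rewrite N0 linear0 normr0.
have hx0 : 0 < `|h x|.
  rewrite lt_neqAle normr_ge0 andbT eq_sym; apply: contra_neq x0 => hx.
  by apply/eqP; rewrite -normr_le0 (le_trans (h_ge Gx))// hx mulr0.
pose y := `|h x|^-1 *: x.
have Gy : proj G y = y by rewrite /y linearZ /= Gx.
have hy1 : `|h y| <= 1.
  by rewrite /y linearZ /= normrZ ger0_norm ?invr_ge0// mulVf// gt_eqF.
have [t [t0 t1 hyt]] := u_hull Gy hy1.
have yt : y = \sum_(i < n) t i *: hull_atom i.
  apply: h_inj => //.
    by rewrite linear_sum /=; apply: eq_bigr => i _; rewrite linearZ /= proj_hull_atom.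
  rewrite hyt linear_sum /=; apply: eq_bigr => i _.
  by rewrite linearZ /= h_hull_atom.
have : N y <= 1.
  rewrite yt -t1; apply: le_trans (Nsum_le _ _ _) _; apply: ler_sum => i _.
  by rewrite NZ ger0_norm// -[leRHS]mulr1 ler_wpM2l// hull_atom_le1.
by rewrite /y NZ ger0_norm ?invr_ge0// ler_pdivrMl// mulr1.
Qed.

(** For [b] in [G] this is the normalization of the basis of [X].  Otherwise the
    coordinate functional of [b] vanishes on the span of [G] and is at most 1 on
    the remaining atoms. *)
Lemma atomic_norm_basis b : b \in F -> N b = 1.
Proof.
move=> bF; have [bG|bG] := boolP (b \in G).
  rewrite atomic_norm_span ?(system_norm seX (hG bG))//.
  have bGs : ([fset b] `<=` G)%fset by rewrite fsub1set.
  by have := proj_sum (fun=> 1) bGs; rewrite big_seq_fset1 scale1r.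
apply/eqP; rewrite eq_le basis_le1//=.
have <- : `|e b b| = 1 by rewrite (system_diag se bF) normr1.
rewrite -[leRHS]mul1r; apply: (Nge (q := fun x => `|e b x|)) => [x y|a x|i].
- by rewrite linearD ler_normD.
- by rewrite linearZ normrZ.
case: (atomP i) => [{}i|y [yM _]|a aF].
- by rewrite e_sum// (negbTE bG) normr0.
- apply: le_trans (system_coef_le _ se bF) _; rewrite mul1r.
  by apply: le_trans yM _; rewrite invf_le1.
- apply: le_trans (system_coef_le _ se bF) _; rewrite mul1r.
  by rewrite (system_norm se aF).
Qed.

(** By the triangle inequality it suffices to project the atoms.  The projection
    of an atom above [u i] stays in the span of [G], where the norm is that of
    its image under [h], which is a coordinate projection of [u i] in [X]. *)
Lemma atomic_norm_proj (H : {fset A}) x : (H `<=` F)%fset ->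
  N (proj H x) <= K * N x.
Proof.
move=> HF; apply: (Nge (q := fun x => N (proj H x))) => [y z|a y|i].
- by rewrite linearD ND.
- by rewrite linearZ NZ.
case: (atomP i) => [{}i|y [yM [k yk]]|b bF].
- pose HG := (H `&` G)%fset; pose z := \sum_(b <- HG) (eX (h b) (u i) : R) *: b.
  have -> : proj H (hull_atom i) = z.
    apply: eq_coef => b bF; rewrite e_proj// !e_sum//.
      by rewrite inE; case: (b \in H).
    exact: fsubset_trans (fsubsetIl _ _) HF.
  rewrite atomic_norm_span; last by apply: proj_sum; exact: fsubsetIr.
  have hinj : {in HG &, injective h}.
    move=> a b; rewrite !inE => /andP[_ aG] /andP[_ bG]; apply: h_inj.
      have aGs : ([fset a] `<=` G)%fset by rewrite fsub1set.
      by have := proj_sum (fun=> 1) aGs; rewrite big_seq_fset1 scale1r.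
    have bGs : ([fset b] `<=` G)%fset by rewrite fsub1set.
    by have := proj_sum (fun=> 1) bGs; rewrite big_seq_fset1 scale1r.
  have -> : h z = \sum_(y <- [fset h b | b in HG]%fset) eX y (u i) *: y.
    rewrite big_imfset// linear_sum; apply: eq_bigr => b _.
    by rewrite linearZ.
  apply: le_trans (_ : K * `|u i| <= _); last first.
    by rewrite -[leRHS]mulr1 ler_wpM2l// (le_trans _ K1).
  apply: (system_proj seX) => y /imfsetP[b /=]; rewrite inE => /andP[_ bG] ->.
  exact: hG.
- apply: le_trans K1; apply: grid_le1; split; first exact: le_trans (proj_le _ _) _.
  exists (fun b => if b \in H then k b else 0).
  apply: eq_coef => b bF; rewrite e_proj// yk !e_sum// bF.
  by case: ifP => //; rewrite mul0r.
- apply: le_trans K1; have [bH|bH] := boolP (b \in H).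
    have -> : proj H b = b; last exact: basis_le1.
    apply: eq_coef => a aF; rewrite e_proj//; case: ifPn => // aH.
    by rewrite (system_offdiag se)// => ab; rewrite ab bH in aH.
  have -> : proj H b = 0; last by rewrite N0.
  apply: eq_coef => a aF; rewrite e_proj// linear0; case: ifPn => // aH.
  by rewrite (system_offdiag se)// => ab; rewrite -ab aH in bH.
Qed.

(** Rounding the coordinates of [y] down to the grid moves it by at most [s] in
    the old norm and, basis vectors having new norm 1, also in the new norm.  If
    [y] has norm at most [1 / M - s], the rounded point is thus an atom and the
    new norm of [y] is at most [1 + s]. *)
Lemma atomic_norm_upper x : let s := #|` F|%:R / m%:R in s < M^-1 ->
  N x <= (1 + s) / (M^-1 - s) * `|x|.
Proof.
move=> s sM; have r0 : 0 < M^-1 - s by rewrite subr_gt0.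
suff small y : `|y| <= M^-1 - s -> N y <= 1 + s.
  have [->|x0] := eqVneq x 0; first by rewrite N0 normr0 mulr0.
  have xn : 0 < `|x| by rewrite normr_gt0.
  have c0 : 0 < (M^-1 - s) / `|x| by rewrite divr_gt0.
  have := small (((M^-1 - s) / `|x|) *: x).
  rewrite normrZ NZ (gtr0_norm c0) divfK ?gt_eqF// => /(_ (lexx _)).
  by rewrite -ler_pdivlMl// invf_div mulrC mulrAC mulrA.
move=> yr; pose k b := Num.floor (m%:R * e b y : R).
have mR : 0 < m%:R :> R by rewrite ltr0n.
have kP b : `|e b y - (k b)%:~R / m%:R| <= m%:R^-1 :> R.
  have /andP[k1 k2] := floor_itv (m%:R * e b y : R).
  rewrite ger0_norm.
    rewrite lerBlDr -(ler_pM2l mR) mulrDr mulfV ?gt_eqF// mulrCA mulfV ?gt_eqF//.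
    by move: k2; rewrite mulr1 addrC intrD => /ltW.
  by rewrite subr_ge0 ler_pdivrMr// mulrC.
have dE : y - grid_point k = \sum_(b <- F) (e b y - (k b)%:~R / m%:R : R) *: b.
  by rewrite [in LHS](span y) -sumrB; apply: eq_bigr => b _; rewrite scalerBl.
have sE : \sum_(b <- F) m%:R^-1 = s :> R.
  by rewrite big_const_seq count_predT iter_addr_0 /s mulr_natl.
have dN : `|y - grid_point k| <= s.
  rewrite dE -sE; apply: le_trans (ler_norm_sum _ _ _) _.
  rewrite big_seq [leRHS]big_seq; apply: ler_sum => b bF.
  by rewrite normrZ (system_norm se bF) mulr1.
have dNN : N (y - grid_point k) <= s.
  rewrite dE -sE; apply: le_trans (Nsum_le _ _ _) _.
  rewrite big_seq [leRHS]big_seq; apply: ler_sum => b bF.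
  by rewrite NZ atomic_norm_basis// mulr1.
rewrite -(subrK (grid_point k) y) addrC; apply: le_trans (ND _ _) _.
apply: lerD => //; apply: grid_le1; split; last by exists k.
rewrite -[grid_point k](subKr y); apply: le_trans (ler_normB _ _) _.
by rewrite -lerBrDr; apply: le_trans yr _; rewrite lerD2l lerN2.
Qed.

Lemma atom_rational i : rational_coordinates [set` F] (atom i).
Proof.
case: (atomP i) => [{}i|y [_ [k ->]]|b bF].
- have /choice[q qP] (b : A) : exists rho : rat, b \in G -> eX (h b) (u i) = ratr rho.
    by have [/(u_rat i)[rho ?]|_] := boolP (b \in G); [exists rho|exists 0].
  exists G, q; split; first exact: G_sub.
  by apply: eq_big_seq => b /qP ->.
- exists F, (fun b => (k b)%:~R / m%:R); split => //; apply: eq_bigr => b _.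
  by rewrite fmorph_div /= ratr_int ratr_nat.
- exists [fset b]%fset, (fun=> 1); split; first by move=> a /=; rewrite inE => /eqP ->.
  by rewrite big_seq_fset1 rmorph1 scale1r.
Qed.

End Mesh.

Lemma exists_polyhedral_norm eps : 0 < eps -> M < 1 + eps ->
  exists (I : finType) (v : I -> A),
    [/\ forall x, exists t, x = \sum_i t i *: v i,
        forall i, rational_coordinates [set` F] (v i),
        forall x, proj G x = x -> atomic_norm v x = `|h x|,
        forall b, b \in F -> atomic_norm v b = 1
      & [/\ forall (H : {fset A}) x, (H `<=` F)%fset ->
              atomic_norm v (proj H x) <= K * atomic_norm v x,
            forall x, `|x| <= M * atomic_norm v x
          & exists2 c, c < 1 + eps & forall x, atomic_norm v x <= c * `|x|]].
Proof.
move=> eps0 Meps; have [m [m0 sM sc]] := exists_mesh #|` F| eps0 M1 Meps.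
exists 'I_(size (atoms m)), (@atom m); split.
- exact: atom_span.
- by move=> i; exact: atom_rational.
- by move=> x; exact: atomic_norm_span.
- by move=> b; exact: atomic_norm_basis.
split.
- by move=> H x; exact: atomic_norm_proj.
- by move=> x; exact: atomic_norm_lower.
- by eexists; [exact: sc|move=> x; exact: atomic_norm_upper].
Qed.

End PolyhedralNorm.

(** * Extension through the renormed space *)

Lemma rational_coef (R : realType) (V : completeNormedModType R) (K : R)
    (B : set V) (e : V -> {linear V -> R^o}) (x b : V) :
  suppression_system K B e -> rational_coordinates B x -> B b ->
  exists rho : rat, e b x = ratr rho.
Proof.
move=> se [F [q [FB ->]]] Bb.
rewrite (system_coef_sum (fun b => ratr (q b)) se FB Bb).
by case: ifP => _; [exists (q b)|exists 0; rewrite rmorph0].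
Qed.

(** Rationality of [X], applied to the span of [G], read inside [X] rather than in
    the subspace type. *)
Lemma coordinate_span_polytope (R : realType) (X : completeNormedModType R)
    (K : R) (B : set X) (e : X -> {linear X -> R^o}) (G : {fset X}) :
  1 <= K -> suppression_system K B e -> rational_based B -> [set` G] `<=` B ->
  exists n (u : 'I_n -> X),
    [/\ forall i, coordinate_sum e G id (u i) = u i,
        forall i b, b \in G -> exists rho : rat, e b (u i) = ratr rho,
        forall i, `|u i| <= 1
      & forall y, coordinate_sum e G id y = y -> `|y| <= 1 ->
          exists t : 'I_n -> R, [/\ forall i, 0 <= t i, \sum_(i < n) t i = 1
            & y = \sum_(i < n) t i *: u i]].
Proof.
move=> K1 se ratB GB.
have cP : continuous (coordinate_sum e G id : {linear X -> X}).
  by apply: (@linear_le_continuous _ _ _ _ K) => x; exact: (system_proj se).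
pose L := fixed_subspace cP.
have GL : [set` G] `<=` subspace_set L.
  move=> b bG; rewrite /= /coordinate_sum.
  rewrite (big_fsetD1 b bG) /= (system_diag se (GB _ bG)) scale1r.
  rewrite big1_fset ?addr0// => a; rewrite !inE => /andP[/eqP ab aG] _.
  by rewrite (system_offdiag se (GB _ aG) (GB _ bG) ab) scale0r.
have spanL x : subspace_set L x -> x = \sum_(b <- G) e b x *: b.
  by move=> /= Lx; rewrite -[LHS]Lx.
have [Lbased Lfd] := spanned_subspace_based se GB GL spanL.
have [n [v [vrat vball]]] := ratB L (ex_intro2 _ _ K K1 Lbased) Lfd.
exists n, (fun i => subspace_val (v i)); split.
- by move=> i; exact: (subspace_valP (v i)).
- move=> i b bG; have bL : b \in in_subspace L by rewrite unfold_in inE; exact: GL.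
  have Bb : subspace_basis B L (InSubspace bL) by exact: GB.
  exact: (rational_coef (restrict_suppression_system se L) (vrat i) Bb).
- move=> i; have : convex_hull v (v i).
    exists (fun j => (j == i)%:R); split; first by move=> j; case: (j == i).
      by rewrite (bigD1 i)//= eqxx big1 ?addr0// => j /negbTE ->.
    rewrite (bigD1 i)//= eqxx scale1r big1 ?addr0// => j /negbTE ->.
    by rewrite scale0r.
  by rewrite -vball.
- move=> y Ly y1; have yL : y \in in_subspace L by rewrite unfold_in inE.
  have : [set x : subspace_type L | `|x| <= 1] (InSubspace yL) by exact: y1.
  rewrite vball => -[t [t0 t1 yt]]; exists t; split=> //.
  transitivity (restrict (L := L) idfun (InSubspace yL)) => //.
  by rewrite yt linear_sum; apply: eq_bigr => i _; rewrite linearZ.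
Qed.

(** Here [h] is the map to be extended from [L], composed with the coordinate
    projection of [A] onto [L]. *)
Section Extension.
Variables (R : realType) (K : R) (X : completeNormedModType R) (BX : set X).
Hypothesis K1 : 1 <= K.
Variable eX : X -> {linear X -> R^o}.
Hypothesis seX : suppression_system K BX eX.
Hypothesis ratX : rational_based BX.
Hypothesis RIX : RI_universal K BX.

Variables (A : completeNormedModType R) (F : {fset A}) (e : A -> {linear A -> R^o}).
Hypothesis se : suppression_system 1 [set` F] e.
Hypothesis span : forall x, x = \sum_(b <- F) e b x *: b.
Variables (G : {fset A}) (L : closed_subspace A) (h : {linear A -> X}) (eps M : R).
Hypothesis GF : (G `<=` F)%fset.
Hypothesis GL : [set` G] `<=` subspace_set L.
Hypothesis projL : forall x, subspace_set L x -> coordinate_sum e G id x = x.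
Hypothesis hG : forall b, b \in G -> BX (h b).
Hypothesis h0 : forall b, b \in F -> b \notin G -> h b = 0.
Hypothesis eps0 : 0 < eps.
Hypothesis M1 : 1 <= M.
Hypothesis Meps : M < 1 + eps.
Hypothesis h_le : forall x, coordinate_sum e G id x = x -> `|h x| <= M * `|x|.
Hypothesis h_ge : forall x, coordinate_sum e G id x = x -> `|x| <= M * `|h x|.

Lemma eps_isometry_extension : exists2 g : {linear A -> X},
  eps_isometry_morphism [set` F] BX eps g &
  forall x, subspace_set L x -> g x = h x.
Proof.
have hinj : {in G &, injective h}.
  have projG b : b \in G -> coordinate_sum e G id b = b.
    by move=> bG; apply: projL; exact: GL.
  by move=> a b /projG Ga /projG Gb; exact: (h_inj h_ge Ga Gb).
pose G' := [fset h b | b in G]%fset.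
have sumG' y : coordinate_sum eX G' id y = \sum_(b <- G) eX (h b) y *: h b.
  by rewrite /coordinate_sum big_imfset.
have G'B : [set` G'] `<=` BX by move=> _ /imfsetP[b /= /hG Bb ->].
have [n [u [u_span u_rat u_le1 u_hull]]] :=
  coordinate_span_polytope K1 seX ratX G'B.
have u_span' i : \sum_(b <- G) eX (h b) (u i) *: h b = u i by rewrite -sumG'.
have u_rat' i b : b \in G -> exists rho : rat, eX (h b) (u i) = ratr rho.
  by move=> bG; apply: u_rat; apply/imfsetP; exists b.
have h_proj' x : coordinate_sum eX G' id (h x) = h x.
  rewrite -(h_proj span GF h0 x) linear_sum [LHS]linear_sum.
  apply: eq_big_seq => b bG; rewrite !linearZ /=; congr (_ *: _).
  rewrite /coordinate_sum (big_fsetD1 (h b)) /=; last by apply/imfsetP; exists b.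
  rewrite (system_diag seX (hG bG)) scale1r big1_fset ?addr0// => a.
  rewrite !inE => /andP[/eqP ab /G'B Ba] _.
  by rewrite (system_offdiag seX Ba (hG bG) ab) scale0r.
have u_hull' x : coordinate_sum e G id x = x -> `|h x| <= 1 ->
    exists t : 'I_n -> R, [/\ forall i, 0 <= t i, \sum_(i < n) t i = 1
      & h x = \sum_(i < n) t i *: u i].
  by move=> _; apply: u_hull.
have [I [v [vspan vrat Nspan Nbasis [Nproj Nlow [c ceps Nup]]]]] :=
  exists_polyhedral_norm se span K1 seX GF hG h0 M1 h_le h_ge u_span' u_rat' u_le1
    u_hull' eps0 Meps.
pose N := atomic_norm v.
pose Neq := @EquivalentNorm R A N (atomic_normD vspan) (atomic_normZ vspan)
  (ex_intro _ M Nlow) (ex_intro _ c Nup).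
(* The renormed space is a rational [K]-based space with the same basis. *)
pose A' := renormed_type Neq.
pose e' (b : A') : {linear A' -> R^o} := renormed_linear Neq (e b).
pose F' : {fset A'} := F.
have se' : suppression_system K [set` F'] e'.
  split.
  - by move=> b bF; exact: Nbasis.
  - exact: (system_diag se).
  - exact: (system_offdiag se).
  - move=> H HF x; apply: Nproj.
    by apply/fsubsetP => b; exact: HF.
have based' : is_K_based K [set` F'].
  exact: (finite_system_is_K_based se').
have fd' : finite_dimensional A' by exact: (@finite_span_fd R A' F' e').
have rat' : rational_fd [set` F'].
  apply: (@symmetric_hull_rational_fd R A' _ _ v) => //.
  by move=> x; exact: (atomic_ballP vspan).
pose L' := renormed_subspace Neq L.
have [Lbased' _] : is_K_based K (subspace_basis [set` F'] L') /\
    finite_dimensional (subspace_type L').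
  apply: (@spanned_subspace_based R A' K [set` F'] e' se' L' G) => // [b|x Lx].
    exact: (fsubsetP GF).
  by rewrite -[LHS](projL Lx).
pose f' : {linear subspace_type L' -> X} :=
  restrict (L := L') (renormed_linear Neq h).
have f'iso : isometry_morphism (subspace_basis [set` F'] L') BX f'.
  have f'N x : `|f' x| = `|x|.
    rewrite -[RHS]/(atomic_norm v (subspace_val x)) Nspan//.
    by apply: projL; exact: (subspace_valP x).
  split => //; split.
    by apply: (@linear_le_continuous _ _ _ _ 1) => x; rewrite f'N mul1r.
  move=> _ [x xF <-]; apply: hG; apply: contrapT => /negP xG.
  have := projL (subspace_valP x); move=> /(congr1 (e (subspace_val x))).
  rewrite (e_proj se _ GF)// (negbTE xG) (system_diag se xF) => /eqP.
  by rewrite eq_sym oner_eq0.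
have [g [[cg gB] giso] gf] :=
  RIX based' fd' rat' (ex_intro2 _ _ K K1 Lbased') f'iso.
pose g0 : {linear A -> X} := g.
have g0N x : `|g0 x| = N x by exact: giso.
exists g0; last first.
  move=> x Lx; have xL : x \in @in_subspace R A' L' by rewrite unfold_in inE.
  exact (gf (@InSubspace R A' L' x xL)).
split; first split.
- by apply: (@linear_le_continuous _ _ _ _ c) => x; rewrite g0N.
- exact: gB.
move=> x /eqP; rewrite -normr_gt0 => x0; rewrite g0N.
have Nx0 : 0 < N x.
  by rewrite -(pmulr_rgt0 _ (lt_le_trans ltr01 M1)) (lt_le_trans x0).
apply/andP; split.
  by rewrite ltr_pdivrMl ?ltr_wpDl//; apply: le_lt_trans (Nlow x) _; rewrite ltr_pM2r.
by apply: le_lt_trans (Nup x) _; rewrite ltr_pM2r.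
Qed.

End Extension.

Theorem theorem5p3 (R : realType) (K : R) (X : completeNormedModType R)
    (BX : set X) :
  1 <= K -> is_K_based K BX -> rational_based BX -> RI_universal K BX ->
  almost_FI_universal 1 BX.
Proof.
move=> K1 [_ /basis_suppression_system[eX seX _]] ratX RIX eps eps0 A BA.
move=> [_ /basis_suppression_system[e se spanF]] fdA L [K' _ [_ nsbL]] f.
move=> [[cf fB] feps].
have [F BF] := (finite_fsetP.1 (system_finite fdA se)).
have {spanF} span := spanF F BF; rewrite {}BF {BA} in se nsbL fB *.
have [eL seL spanL] := basis_suppression_system nsbL.
have finL : finite_set (subspace_basis [set` F] L).
  apply: finite_preimage; last exact: finite_fset.
  by move=> x y _ _; exact: val_inj.
have [FL EFL] := (finite_fsetP.1 finL).
have {spanL} spanL := spanL FL EFL.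
have seF : suppression_system K' [set` FL] eL by rewrite -EFL.
have memFL b : b \in FL -> subspace_val b \in F.
  by move=> bFL; have : [set` FL] b by []; rewrite -EFL.
pose G := [fset subspace_val b | b in FL]%fset.
have GP a : a \in G -> exists2 b, b \in FL & a = subspace_val b.
  by move=> /imfsetP[b /= bFL ->]; exists b.
have GF : (G `<=` F)%fset by apply/fsubsetP => _ /GP[b /memFL bF ->].
have GL : [set` G] `<=` subspace_set L by move=> _ /GP[b _ ->]; exact: subspace_valP.
(* The default value 0 of [insubd] is not reached: [G] is contained in [L]. *)
pose phi (a : A) : X := f (insubd 0 a).
pose h : {linear A -> X} := coordinate_sum e G phi.
have sumG (W : completeNormedModType R) (p : A -> W) a : a \in G ->
    coordinate_sum e G p a = p a.
  move=> aG; rewrite /coordinate_sum (big_fsetD1 a aG) /=.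
  have aF := fsubsetP GF _ aG.
  rewrite (system_diag se aF) scale1r big1_fset ?addr0// => b.
  rewrite !inE => /andP[/eqP ba /(fsubsetP GF) bF] _.
  by rewrite (system_offdiag se bF aF ba) scale0r.
(* Linear maps on [L] that agree on its finite basis agree. *)
have extL (W : completeNormedModType R) (T : {linear A -> W})
    (S : {linear subspace_type L -> W}) :
    (forall b, b \in FL -> T (subspace_val b) = S b) ->
    forall y, T (subspace_val y) = S y.
  move=> TS y; rewrite -[LHS]/(restrict T y) (spanL y) !linear_sum.
  by apply: eq_big_seq => b bFL; rewrite !linearZ /=; congr (_ *: _); exact: TS.
have valG b : b \in FL -> subspace_val b \in G by move=> bFL; apply/imfsetP; exists b.
have projL x : subspace_set L x -> coordinate_sum e G id x = x.
  move=> Lx; have xL : x \in in_subspace L by rewrite unfold_in inE.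
  pose S : {linear subspace_type L -> A} := restrict (idfun : {linear A -> A}).
  apply: (extL _ (coordinate_sum e G id) S _ (InSubspace xL)) => b bFL.
  exact: (sumG _ id _ (valG _ bFL)).
have hf y : h (subspace_val y) = f y.
  apply: extL => b bFL; rewrite /h /= sumG; last exact: valG.
  by rewrite /phi valKd.
have inL x : coordinate_sum e G id x = x ->
    exists y : subspace_type L, x = subspace_val y.
  move=> <-; exists (\sum_(b <- FL) e (subspace_val b) x *: b).
  by rewrite (sum_subspace_val FL (fun b => e b x)).
have f_bound y : y != 0 -> `|f y| < (1 + eps) * `|y| /\ `|y| < (1 + eps) * `|f y|.
  move=> /eqP/feps/andP[l r]; split=> //; rewrite -ltr_pdivrMl//.
  by rewrite ltr_wpDl.
have e1 : 0 < 1 + eps by rewrite ltr_wpDl.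
have nZ a y : (1 + eps) * `|f (a *: y)| = `|a| * ((1 + eps) * `|f y|).
  by rewrite linearZ normrZ mulrCA.
have cq : continuous (fun y => (1 + eps) * `|f y|).
  by move=> y; exact: (cvgM (cvg_cst _) (cvg_norm (cf y))).
have cn : continuous (fun y : subspace_type L => (1 + eps) * `|y|).
  by move=> y; exact: (cvgM (cvg_cst _) (@norm_continuous _ _ y)).
have [t1 t11 ft1] : exists2 t, t < 1 & forall y, `|f y| <= t * ((1 + eps) * `|y|).
  apply: (uniform_strict_ratio (p := fun y => `|f y|) seF spanL) => //.
  - by move=> y; exact: (cvg_norm (cf y)).
  - by move=> a y; rewrite linearZ normrZ.
  - by move=> a y; rewrite normrZ mulrCA.
  - by move=> y y0; split; [rewrite mulr_gt0// normr_gt0|have [] := f_bound _ y0].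
have [t2 t21 ft2] : exists2 t, t < 1 & forall y, `|y| <= t * ((1 + eps) * `|f y|).
  apply: (uniform_strict_ratio (p := fun y => `|y|) seF spanL) => //.
  - exact: norm_continuous.
  - exact: normrZ.
  - move=> y y0; have [_ yf] := f_bound _ y0; split => //.
    by apply: le_lt_trans yf.
(* [M] has to be at least 1 for the grid to lie in the unit ball of [A]. *)
pose M := Num.max 1 (Num.max t1 t2 * (1 + eps)).
have M1 : 1 <= M by rewrite le_max lexx.
have Meps : M < 1 + eps.
  by rewrite gt_max ltrDl eps0 gtr_pMl// gt_max t11 t21.
have tM t : t <= Num.max t1 t2 -> t * (1 + eps) <= M.
  by move=> tm; rewrite le_max ler_pM2r// tm orbT.
have h_le x : coordinate_sum e G id x = x -> `|h x| <= M * `|x|.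
  move=> /inL[y ->]; rewrite hf; apply: le_trans (ft1 y) _.
  by rewrite mulrA ler_wpM2r// tM// le_max lexx.
have h_ge x : coordinate_sum e G id x = x -> `|x| <= M * `|h x|.
  move=> /inL[y ->]; rewrite hf; apply: le_trans (ft2 y) _.
  by rewrite mulrA ler_wpM2r// tM// le_max lexx orbT.
have hG b : b \in G -> BX (h b).
  move=> /GP[b' b'FL ->]; rewrite hf; apply: fB; exists b' => //.
  exact: memFL.
have h0 b : b \in F -> b \notin G -> h b = 0.
  move=> bF bG; rewrite /h /= /coordinate_sum big1_fset// => a aG _.
  rewrite (system_offdiag se (fsubsetP GF _ aG) bF) ?scale0r// => ab.
  by rewrite ab (negbTE bG) in aG.
have [g geps gh] := eps_isometry_extension K1 seX ratX RIX se span GF GL projL hG h0 eps0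
  M1 Meps h_le h_ge.
exists g => // y; rewrite gh ?hf//; exact: subspace_valP.
Qed.
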